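(* Let $X$ be a Polish space, let $\mathscr{H}(K)$ be a reproducing kernel Hilbert space of Borel measurable functions $X\to\mathbb{F}$, let $\mu$ be a Borel probability measure on $X$, let $0<p<\infty$ and $\lambda>0$. Let $g:X\to\mathbb{F}$ and $c:\mathbb{F}\times\mathbb{F}\to\mathbb{R}^+=[0,\infty)$ be Borel measurable functions such that $c(0,g(\cdot))\in L^1(X,\mu)$ and, for every $z\in\mathbb{F}$, $c(\cdot,z)$ is lower semicontinuous. Then the problem $$\inf_{f\in\mathscr{H}(K)} \int_X c(f(x),g(x))\,d\mu(x)+\lambda\|f\|_{\mathscr{H}(K)}^p$$ admits an optimizer $\hat f\in\mathscr{H}(K)$ (an element attaining the infimum). Furthermore, when $p>1$ and $c(\cdot,z)$ is convex for every $z\in\mathbb{F}$, the optimizer is unique.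
   Context: $\mathbb{F}=\mathbb{R}$ or $\mathbb{C}$. A reproducing kernel Hilbert space (RKHS) on $X$ is a vector subspace $\mathscr{H}$ of the space of all functions $X\to\mathbb{F}$ equipped with a Hilbert space inner product $\langle\cdot,\cdot\rangle$ ($\mathbb{F}$-linear in the first argument) such that each evaluation functional $f\mapsto f(x)$ is bounded. For $x\in X$, $k_x\in\mathscr{H}$ is the unique vector with $f(x)=\langle f,k_x\rangle$ for all $f\in\mathscr{H}$; the reproducing kernel is $K(y,x)=k_x(y)$, and $\mathscr{H}(K)$ denotes the RKHS with reproducing kernel $K$. Standing assumptions: $X$ is a Polish space, and all functions and measures are Borel measurable. *)

(* Defs.v *)
From HB Require Import structures.
From mathcomp Require Import all_boot all_order all_algebra.
From mathcomp Require Import sesquilinear.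
From mathcomp Require Import complex.
From mathcomp Require Import all_classical all_reals all_analysis.

Set Implicit Arguments.
Unset Strict Implicit.
Unset Printing Implicit Defensive.

Import Order.TTheory GRing.Theory Num.Theory.
Import numFieldNormedType.Exports.

Local Open Scope classical_set_scope.
Local Open Scope ring_scope.

Inductive scalar_kind := RealScalars | ComplexScalars.

Definition scalars (R : realType) (k : scalar_kind) : numFieldType :=
  match k with RealScalars => R | ComplexScalars => R[i] end.

Definition scalar_of_real (R : realType) (k : scalar_kind) : R -> scalars R k :=
  match k return R -> scalars R k with
  | RealScalars => id
  | ComplexScalars => real_complex R
  end.

Definition scalar_re (R : realType) (k : scalar_kind) : scalars R k -> R :=
  match k return scalars R k -> R with
  | RealScalars => id
  | ComplexScalars => @complex.Re R
  end.

Definition scalar_conj (R : realType) (k : scalar_kind) :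
    scalars R k -> scalars R k :=
  match k return scalars R k -> scalars R k with
  | RealScalars => id
  | ComplexScalars => fun z => (z^*)%C
  end.

(* The order of [scalars R k] only relates numbers with the same imaginary part,
   and the norm [`|z|] is again an element of [scalars R k]; [scalar_abs] is the
   absolute value as a real number. *)
Definition scalar_abs (R : realType) (k : scalar_kind) (z : scalars R k) : R :=
  scalar_re `|z|.

Definition cauchy_sequence (R : realType) (T : Type) (d : T -> T -> R)
    (u : nat -> T) : Prop :=
  forall e : R, 0 < e -> exists N : nat, forall m n : nat,
    (N <= m)%N -> (N <= n)%N -> d (u m) (u n) < e.

Definition polish (R : realType) (X : topologicalType) : Prop :=
  (exists D : set X, countable D /\ dense D) /\
  exists d : X -> X -> R,
    [/\ (forall x y, d x y = 0 <-> x = y),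
        (forall x y, d x y = d y x),
        (forall x y z, d x z <= d x y + d y z),
        (forall (x : X) (A : set X),
          nbhs x A <-> exists2 e : R, 0 < e & [set y | d x y < e] `<=` A) &
        (forall u : nat -> X, cauchy_sequence d u ->
          exists l : X, u @ \oo --> l)].

HB.instance Definition _ (S T : ptopologicalType) := Topological.on (S * T)%type.

(* The pointed structure is what the library requires of a measurable type; a
   space that carries a probability measure is nonempty. *)
Definition borel (T : ptopologicalType) := g_sigma_algebraType (@open T).
HB.instance Definition _ (T : ptopologicalType) := Measurable.on (borel T).

Definition borel_fun (S T : ptopologicalType) (f : S -> T) : Prop :=
  measurable_fun [set: borel S] (f : borel S -> borel T).

Section subspace_type.
Context {F : numFieldType} {X : Type} (S : submodClosed (X -> F)).

Definition subspace_type := {f : X -> F | f \in S}.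

HB.instance Definition _ := SubChoice.on subspace_type.
HB.instance Definition _ := [SubChoice_isSubLmodule of subspace_type by <:].

End subspace_type.

Definition dot_norm (R : realType) (k : scalar_kind)
    (U : lmodType (scalars R k)) (inner : U -> U -> scalars R k) (f : U) : R :=
  Num.sqrt (scalar_re (inner f f)).

Record rkhs (R : realType) (k : scalar_kind) (X : Type) := Rkhs {
  rkhs_space : submodClosed (X -> scalars R k);
  inner : {dot (subspace_type rkhs_space) for @scalar_conj R k};
  rkhs_complete : forall u : nat -> subspace_type rkhs_space,
    cauchy_sequence (fun f g => dot_norm inner (f - g)) u ->
    exists l : subspace_type rkhs_space,
      (fun n => dot_norm inner (u n - l)) @ \oo --> (0 : R);
  rkhs_eval_bounded : forall x : X, exists C : R,
    forall f : subspace_type rkhs_space,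
      scalar_abs (val f x) <= C * dot_norm inner f
}.

Definition rkhs_elt (R : realType) (k : scalar_kind) (X : Type)
  (H : rkhs R k X) := subspace_type (rkhs_space H).
Coercion rkhs_elt : rkhs >-> Sortclass.

Definition rkhs_norm (R : realType) (k : scalar_kind) (X : Type)
  (H : rkhs R k X) (f : H) : R := dot_norm (inner H) f.

(* The vector k_x; it exists and is unique by the Riesz representation theorem,
   so the default value of [xget] is never used. *)
Definition representer (R : realType) (k : scalar_kind) (X : Type)
    (H : rkhs R k X) (x : X) : H :=
  xget (0 : subspace_type (rkhs_space H))
    [set kx | forall f : H, val f x = inner H f kx].

Definition reproducing_kernel (R : realType) (k : scalar_kind) (X : Type)
    (H : rkhs R k X) : X -> X -> scalars R k :=
  fun y x => val (representer H x) y.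

Definition convex_scalar_fun (R : realType) (k : scalar_kind)
    (h : scalars R k -> R) : Prop :=
  forall (w1 w2 : scalars R k) (t : R), 0 <= t -> t <= 1 ->
    h (scalar_of_real k t * w1 + scalar_of_real k (1 - t) * w2)
      <= t * h w1 + (1 - t) * h w2.

Definition objective (R : realType) (k : scalar_kind) (X : ptopologicalType)
    (H : rkhs R k X) (mu : probability (borel X) R) (p lambda : R)
    (g : X -> scalars R k) (c : scalars R k * scalars R k -> R) (f : H) : \bar R :=
  ((\int[mu]_x (c (val f x, g x))%:E) + (lambda * (rkhs_norm f `^ p))%:E)%E.

Definition optimizer (T : Type) (R : realType) (J : T -> \bar R) (t : T) : Prop :=
  J t = ereal_inf (range J).

(* Main.v *)
Require Import Defs.
From HB Require Import structures.
From mathcomp Require Import all_boot all_order all_algebra.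
From mathcomp Require Import sesquilinear.
From mathcomp Require Import complex.
From mathcomp Require Import all_classical all_reals all_analysis.
From mathcomp Require Import measurable_realfun.
From mathcomp Require Import lra ring.

(* Existence is the direct method: a minimizing sequence is bounded because of the
   penalty, a subsequence converges weakly, hence pointwise with a norm-dominated
   limit, and Fatou's lemma applied to the cost plus the constant penalty shows that
   the limit is a minimizer. The scalars are restricted to the reals, so that a
   single real Hilbert space treats both cases, and weak sequential compactness is
   proved without the Riesz theorem: the intersection of the closed convex hulls of
   the tails of a bounded sequence is nonempty, and along a subsequence for which all
   inner products with the terms converge it is a single point, which does not change
   on passing to further subsequences.

   Uniqueness: by strict convexity of the norm penalty the midpoint of two distinct
   optimizers would be strictly better. *)

Import Order.TTheory GRing.Theory Num.Theory.
Import numFieldNormedType.Exports.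

Local Open Scope classical_set_scope.
Local Open Scope ring_scope.

(** * Simultaneous convergence along a subsequence *)

Lemma ultra_fmap {S T : Type} (f : S -> T) (U : set_system S) :
  UltraFilter U -> UltraFilter (f @ U).
Proof.
move=> UU; split; first exact: fmap_proper_filter.
move=> G GG UG; apply/seteqP; split=> // A GA.
have [//|UA] := in_ultra_setVsetC (f @^-1` A) UU.
by have [x []] := filter_ex (filterI GA (UG (~` A) UA)).
Qed.

(** An ultrafilter finer than the eventual filter makes all rows converge at once, by compactness of
    segments. Choosing [s k] beyond [k] and close to the limits of the first [k + 1] rows then takes
    the place of successive extractions. *)
Lemma diagonal_subsequence {R : realType} (a : nat -> nat -> R) (M : nat -> R) :
  (forall m n, `|a m n| <= M m) ->
  exists s : nat -> nat, (forall n, (n <= s n)%N) /\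
    forall m, exists l : R, a m (s n) @[n --> \oo] --> l.
Proof.
move=> aM; have [U [UU ooU]] := ultraFilterLemma (@eventually_filter).
have /choice[L hL] m : exists l : R, a m @ U --> l.
  have := @segment_compact R (- M m) (M m); rewrite compact_ultra.
  move=> /(_ (a m @ U) (ultra_fmap _ _ UU))[].
    by apply: (@filterE _ U) => n /=; rewrite in_itv/= -ler_norml.
  by move=> l [_ hl]; exists l.
have /choice[s hs] k : exists n, (k <= n)%N /\
    forall m : 'I_k.+1, `|L m - a m n| < k.+1%:R^-1.
  have Uk : U [set n | (k <= n)%N] by apply: ooU; exists k.
  have UL : U [set n | forall m : 'I_k.+1, `|L m - a m n| < k.+1%:R^-1].
    apply: filter_forall => m; move/cvgrPdist_lt : (hL m); apply.
    by rewrite invr_gt0.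
  by have [n []] := filter_ex (filterI Uk UL); exists n.
exists s; split=> [n|m]; first exact: (hs n).1.
exists (L m); apply/cvgrPdist_lt => e e0.
near=> n.
have mn : (m < n.+1)%N by rewrite ltnS; near: n; exists m.
apply: lt_trans ((hs n).2 (Ordinal mn)) _.
by near: n; exact: (near_infty_natSinv_lt (PosNum e0)).
Unshelve. all: by end_near. Qed.

(** * Real inner product spaces *)

Section real_inner_product.
Context {R : realType} {V : lmodType R} (B : {dot V for (idfun : R -> R)}).

Definition norm_of (v : V) : R := Num.sqrt (B v v).

Lemma dot_sym u v : B u v = B v u.
Proof. by rewrite hermitian_subproof expr0 mul1r. Qed.

Lemma dotDl u v w : B (u + v) w = B u w + B v w.
Proof. by rewrite linearDl. Qed.

Lemma dotZl a u w : B (a *: u) w = a * B u w.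
Proof. by rewrite linearZl_LR. Qed.

Lemma dotDr u v w : B u (v + w) = B u v + B u w.
Proof. by rewrite linearDr. Qed.

Lemma dotZr a u w : B u (a *: w) = a * B u w.
Proof. by rewrite dot_sym dotZl dot_sym. Qed.

Lemma dotBr u v w : B u (v - w) = B u v - B u w.
Proof. by rewrite linearBr. Qed.

Lemma dotBl u v w : B (u - v) w = B u w - B v w.
Proof. by rewrite linearBl. Qed.

Lemma dot_ge0 u : 0 <= B u u.
Proof.
have [->|u0] := eqVneq u 0; first by rewrite linear0l.
exact/ltW/neq0_dnorm_gt0.
Qed.

Lemma dot_eq0 u : B u u = 0 -> u = 0.
Proof.
by move=> Bu; apply/eqP/negPn/negP => /(neq0_dnorm_gt0 (s := B)); rewrite Bu ltxx.
Qed.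

Lemma norm_of_ge0 u : 0 <= norm_of u. Proof. exact: sqrtr_ge0. Qed.

Lemma sqr_norm_of u : norm_of u ^+ 2 = B u u.
Proof. by rewrite sqr_sqrtr// dot_ge0. Qed.

Lemma cauchy_schwarz u v : B u v <= norm_of u * norm_of v.
Proof.
have [->|v0] := eqVneq v 0.
  by rewrite linear0r mulr_ge0 ?norm_of_ge0.
have vv := neq0_dnorm_gt0 (s := B) _ v0.
rewrite (le_trans (ler_norm _))// -[leLHS]sqrtr_sqr -sqrtrM ?dot_ge0// ler_sqrt; last first.
  by rewrite mulr_ge0// dot_ge0.
(* The inner product of this vector with itself is [B v v * (B u u * B v v - B u v ^+ 2)]. *)
have := dot_ge0 (B v v *: u - B u v *: v).
rewrite dotBl !dotBr !dotZl !dotZr (dot_sym v u) => h.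
rewrite -subr_ge0 -(pmulr_rge0 _ vv); apply: le_trans h _.
by rewrite le_eqVlt; apply/orP; left; apply/eqP; ring.
Qed.

Lemma norm_ofN u : norm_of (- u) = norm_of u.
Proof. by rewrite /norm_of linearNl linearNr opprK. Qed.

(** Written with the midpoint, which stays in any convex set containing [u] and [v]: this is the
    form that bounds the distance of nearly minimal points. *)
Lemma parallelogram u v :
  norm_of (u - v) ^+ 2 =
    2 * norm_of u ^+ 2 + 2 * norm_of v ^+ 2 - 4 * norm_of (2^-1 *: (u + v)) ^+ 2.
Proof.
rewrite !sqr_norm_of !dotZl !dotZr dotBl !dotBr dotDl !dotDr (dot_sym v u); by field.
Qed.

Lemma norm_of_midpoint_le u v :
  norm_of (2^-1 *: (u + v)) <= (norm_of u + norm_of v) / 2.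
Proof.
rewrite -(@ler_pXn2r _ 2) ?nnegrE ?divr_ge0 ?addr_ge0 ?norm_of_ge0//.
have := cauchy_schwarz u v; rewrite exprMn sqrrD !sqr_norm_of.
rewrite dotZl dotZr dotDl !dotDr (dot_sym v u); lra.
Qed.

(** * Convex hulls of tails and weak sequential compactness *)

Definition bounded_functional (phi : {scalar V}) :=
  exists C, forall v, `|phi v| <= C * norm_of v.

Lemma bounded_functionalN phi : bounded_functional phi -> bounded_functional (\- phi).
Proof. by move=> [C hC]; exists C => v; rewrite /= normrN. Qed.

(* The closed convex hull of the tail, written as an intersection of half-spaces. *)
Definition tail_hull (f : nat -> V) (N : nat) : set V :=
  [set h | forall phi : {scalar V}, bounded_functional phi ->
    forall c, (forall n, (N <= n)%N -> phi (f n) <= c) -> phi h <= c].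

Lemma tail_hull_mem f N n : (N <= n)%N -> tail_hull f N (f n).
Proof. by move=> Nn phi _ c; exact. Qed.

Lemma tail_hullS f N M : (N <= M)%N -> tail_hull f M `<=` tail_hull f N.
Proof.
by move=> NM h hM phi phib c fc; apply: (hM phi phib c) => n Mn; apply: fc; exact: leq_trans Mn.
Qed.

Lemma tail_hull_mid f N u v :
  tail_hull f N u -> tail_hull f N v -> tail_hull f N (2^-1 *: (u + v)).
Proof.
move=> hu hv phi phib c fc; rewrite linearZ/= linearD/=.
have := hu phi phib c fc; have := hv phi phib c fc; rewrite /GRing.scale/=; lra.
Qed.

Definition dot_fun (w v : V) : R := B v w.
Fact dot_fun_linear w : linear_for *%R (dot_fun w).
Proof. by move=> a u v; rewrite /dot_fun dotDl dotZl. Qed.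
HB.instance Definition _ w :=
  GRing.isLinear.Build R V R *%R (dot_fun w) (@dot_fun_linear w).

Lemma dot_fun_bounded w : bounded_functional (dot_fun w).
Proof.
exists (norm_of w) => v; rewrite ler_norml /= /dot_fun mulrC cauchy_schwarz andbT lerNl.
by rewrite -linearNl -(norm_ofN v) cauchy_schwarz.
Qed.

Context (B_complete : forall u : nat -> V,
  cauchy_sequence (fun f g => norm_of (f - g)) u ->
  exists l, (fun n => norm_of (u n - l)) @ \oo --> (0 : R)).

(* The limit is that of nearly norm-minimal points of the convex sets [tail_hull f N],
   a Cauchy sequence by the parallelogram law. *)
Lemma tail_hull_nonempty (f : nat -> V) (M : R) :
  (forall n, norm_of (f n) <= M) -> exists h, forall N, tail_hull f N h.
Proof.
move=> fM.
pose sqn N := [set norm_of h ^+ 2 | h in tail_hull f N].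
have sqn_lb N : lbound (sqn N) 0 by move=> _ [h _ <-]; exact: sqr_ge0.
have sqn_f N n : (N <= n)%N -> sqn N (norm_of (f n) ^+ 2).
  by move=> Nn; exists (f n) => //; exact: tail_hull_mem.
have sqn_inf N : has_inf (sqn N).
  by split; [exists (norm_of (f N) ^+ 2); exact: sqn_f|exists 0].
pose d N := inf (sqn N).
have d_le N h : tail_hull f N h -> d N <= norm_of h ^+ 2.
  by move=> hh; apply: ge_inf; [exact: (sqn_inf N).2|exists h].
have d_sup : has_sup (range d).
  split; first by exists (d 0%N); exists 0%N.
  exists (M ^+ 2) => _ [N _ <-]; apply: le_trans (d_le N (f N) _) _.
    exact: tail_hull_mem.
  by rewrite lerXn2r ?nnegrE ?norm_of_ge0//; apply: le_trans (fM 0%N); rewrite norm_of_ge0.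
have /choice[h hP] N : exists h, tail_hull f N h /\ norm_of h ^+ 2 < d N + N.+1%:R^-1.
  have [|_ [h hh <-] hd] := inf_adherent (E := sqn N) (eps := N.+1%:R^-1) _ (sqn_inf N).
    by rewrite invr_gt0.
  by exists h.
pose D := sup (range d).
have dD N : d N <= D by apply: ub_le_sup; [exact: d_sup.2|exists N].
have h_cauchy : cauchy_sequence (fun f g => norm_of (f - g)) h.
  (* For late [m] and [n] the squared norms are below [D + e'], while that of the midpoint is at
     least [d N1 > D - e']. The parallelogram law then puts the squared distance below [8 * e'],
     which is less than [e ^+ 2]. *)
  move=> e e0; pose e' := e ^+ 2 / 9.
  have e'0 : 0 < e' by rewrite divr_gt0 ?exprn_gt0.
  have [_ [N1 _ <-] dN1] := sup_adherent e'0 d_sup.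
  have [N2 _ hN2] := near_infty_natSinv_lt (PosNum e'0).
  have hl n : (maxn N1 N2 <= n)%N -> norm_of (h n) ^+ 2 < D + e' /\ tail_hull f N1 (h n).
    rewrite geq_max => /andP[n1 n2]; have [hn1 hn2] := hP n; split.
      by apply: lt_le_trans hn2 _; rewrite lerD// ltW//; exact: hN2.
    exact: tail_hullS hn1.
  exists (maxn N1 N2) => m n /hl[m1 m2] /hl[n1 n2].
  rewrite -(@ltr_pXn2r _ 2) ?nnegrE ?norm_of_ge0 ?ltW// parallelogram.
  have := d_le _ _ (tail_hull_mid _ _ _ _ m2 n2).
  have : e ^+ 2 = 9 * e' by rewrite /e'; field.
  move: dN1; rewrite -/D; nra.
have [l hl] := B_complete _ h_cauchy.
exists l => N phi phib c fc.
apply/ler_addgt0Pr => e e0.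
have [C phiC] := phib.
(* [C] may be zero or negative, so [|C| + 1] serves as the divisor. *)
have C0 : 0 < `|C| + 1 by rewrite ltr_wpDl.
move/cvgrPdist_lt : hl => /(_ (e / (`|C| + 1))); rewrite divr_gt0// => /(_ isT)[n0 _ hn].
have := hn (maxn N n0) (leq_maxr _ _).
rewrite sub0r normrN ger0_norm ?norm_of_ge0//= ltr_pdivlMr// => hln.
have := (tail_hullS _ _ _ (leq_maxl N n0) _ (hP (maxn N n0)).1) phi phib c fc.
have := phiC (h (maxn N n0) - l); rewrite linearB/= ler_norml => /andP[+ _].
have : C * norm_of (h (maxn N n0) - l) <= e.
  rewrite (le_trans _ (ltW hln))// mulrC ler_wpM2l ?norm_of_ge0//.
  by rewrite (le_trans (ler_norm _))// lerDl.
lra.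
Qed.

(** On a late tail [phi] lies within [e] of [l], and a point of the hull inherits upper bounds for
    both [phi] and its opposite. *)
Lemma tail_hull_lim f h (phi : {scalar V}) (l : R) : (forall N, tail_hull f N h) ->
  bounded_functional phi -> phi (f n) @[n --> \oo] --> l -> phi h = l.
Proof.
move=> hh phib /cvgrPdist_le phil.
have Nphib := bounded_functionalN _ phib.
apply/eqP; rewrite eq_le; apply/andP; split; apply/ler_addgt0Pr => e e0;
  have [N _ hN] := phil _ e0.
- apply: (hh N phi) => // n /hN; rewrite ler_norml; lra.
- rewrite -lerBlDr -lerN2 opprB.
  have := hh N _ Nphib (e - l); rewrite /=; apply => n /hN /=; rewrite ler_norml; lra.
Qed.

Lemma bounded_weak_subsequence f M : (forall n, norm_of (f n) <= M) ->
  exists s h, (forall n, (n <= s n)%N) /\ forall phi : {scalar V}, bounded_functional phi ->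
    phi (f (s n)) @[n --> \oo] --> phi h.
Proof.
move=> fM.
have [m n|s [s_ge sB]] :=
    diagonal_subsequence (fun m n => B (f n) (f m)) (fun m => M * norm_of (f m)).
  rewrite ler_norml lerNl -linearNl.
  by rewrite !(le_trans (cauchy_schwarz _ _)) ?norm_ofN// ler_wpM2r// norm_of_ge0.
have /choice[L hL] := sB.
have [h hh] := tail_hull_nonempty (f \o s) M (fun n => fM (s n)).
exists s, h; split => //.
(* Both points have inner product [L m] with each [f m], so [h' - h] is orthogonal to every term. By
   [tail_hull_lim] it is then orthogonal to [h] and to [h'], hence to itself. *)
have uniq t h' : (forall n, (n <= t n)%N) -> (forall N, tail_hull (f \o s \o t) N h') -> h' = h.
  move=> t_ge hh'.
  have Bh m : B h (f m) = L m.
    apply: (tail_hull_lim _ _ (dot_fun (f m)) _ hh); first exact: dot_fun_bounded.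
    exact: hL.
  have t_oo : t @ \oo --> \oo.
    by move=> A [n _ nA]; exists n => // k /= nk; apply: nA; exact: leq_trans (t_ge k).
  have Bh' m : B h' (f m) = L m.
    apply: (tail_hull_lim _ _ (dot_fun (f m)) _ hh'); first exact: dot_fun_bounded.
    exact: (cvg_comp _ _ t_oo (hL m)).
  have Bw m : B (f m) (h' - h) = 0 by rewrite dotBr !(dot_sym (f m)) Bh Bh' subrr.
  have Bwl g u : (forall N, tail_hull (f \o g) N u) -> B u (h' - h) = 0.
    move=> gu; apply: (tail_hull_lim _ _ (dot_fun (h' - h)) _ gu (dot_fun_bounded _)).
    rewrite (_ : (fun n => _) = cst 0); first exact: cvg_cst.
    by apply/funext => n; exact: Bw.
  apply/eqP; rewrite -subr_eq0; apply/eqP/dot_eq0.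
  by rewrite dotBl (Bwl (s \o t) h')// (Bwl s h)// subrr.
(* Otherwise [phi] would be at least [c] along indices [t] tending to infinity. The hulls of the
   tails of that subsequence share a point, which is [h] by [uniq], so that [phi h] would be at
   least [c]. *)
have ev (phi : {scalar V}) c : bounded_functional phi -> phi h < c ->
    \forall n \near \oo, phi (f (s n)) < c.
  move=> phib hc; apply: contrapT => nev.
  have /choice[t ht] N : exists n, (N <= n)%N /\ c <= phi (f (s n)).
    apply: contrapT => nN; apply: nev; exists N => // n /= Nn; rewrite ltNge.
    by apply/negP => cn; apply: nN; exists n.
  have [h' hh'] := tail_hull_nonempty (f \o s \o t) M (fun n => fM (s (t n))).
  have Nphib := bounded_functionalN _ phib.
  have := hh' 0%N _ Nphib (- c); rewrite (uniq t h' (fun n => (ht n).1) hh') /=.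
  move=> {}hh'; apply/negP: hc; rewrite -leNgt -lerN2; apply: hh' => n _.
  by rewrite lerN2 (ht n).2.
move=> phi phib; apply/cvgrPdist_lt => e e0.
have Nphib := bounded_functionalN _ phib.
have := ev phi (phi h + e) phib; rewrite ltrDl => /(_ e0).
have := ev (\- phi) (- phi h + e) Nphib; rewrite ltrDl => /(_ e0).
apply: filterS2 => n /=; rewrite ltr_norml; lra.
Qed.

End real_inner_product.

(** * Real and imaginary parts of scalars *)

Definition scalar_im (R : realType) (k : scalar_kind) : scalars R k -> R :=
  match k return scalars R k -> R with
  | RealScalars => fun=> 0
  | ComplexScalars => @complex.Im R
  end.
Arguments scalar_im {R k}.

Section scalars.
Context {R : realType} {k : scalar_kind}.
Implicit Types z w : scalars R k.

Lemma scalar_of_real_monoid : monoid_morphism (@scalar_of_real R k).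
Proof. by case: k; split=> // x y /=; rewrite rmorphM. Qed.

Lemma scalar_of_real_nmod : nmod_morphism (@scalar_of_real R k).
Proof. by case: k; split=> // x y /=; rewrite rmorphD. Qed.

HB.instance Definition _ := GRing.isNmodMorphism.Build R (scalars R k)
  (@scalar_of_real R k) scalar_of_real_nmod.
HB.instance Definition _ := GRing.isMonoidMorphism.Build R (scalars R k)
  (@scalar_of_real R k) scalar_of_real_monoid.

Lemma scalar_reD z w : scalar_re (z + w) = scalar_re z + scalar_re w.
Proof. by case: k z w => //= -[a b] [c d]. Qed.

Lemma scalar_reB z w : scalar_re (z - w) = scalar_re z - scalar_re w.
Proof. by case: k z w => //= -[a b] [c d]. Qed.

Lemma scalar_reZ (a : R) z : scalar_re (scalar_of_real k a * z) = a * scalar_re z.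
Proof. by case: k z => //= -[b c] /=; rewrite mul0r subr0. Qed.

Lemma scalar_re_conj z : scalar_re (scalar_conj z) = scalar_re z.
Proof. by case: k z => //= -[b c]. Qed.

Lemma scalar_conj_real (a : R) :
  scalar_conj (scalar_of_real k a) = scalar_of_real k a.
Proof. by case: k => //=; rewrite oppr0. Qed.

Lemma scalar_re_gt0 z : 0 < z -> 0 < scalar_re z.
Proof. by case: k z => //= -[b c]; rewrite ltcE => /andP[]. Qed.

Lemma scalar_imD z w : scalar_im (z + w) = scalar_im z + scalar_im w.
Proof. by case: k z w => /= [x y|[a b] [c d]//]; rewrite addr0. Qed.

Lemma scalar_imB z w : scalar_im (z - w) = scalar_im z - scalar_im w.
Proof. by case: k z w => /= [x y|[a b] [c d]//]; rewrite subr0. Qed.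

Lemma scalar_imZ (a : R) z : scalar_im (scalar_of_real k a * z) = a * scalar_im z.
Proof. by case: k z => /= [x|[b c] /=]; rewrite ?mulr0// mul0r addr0. Qed.

Lemma scalar_re_abs z : `|scalar_re z| <= scalar_abs z.
Proof.
rewrite /scalar_abs; case: k z => //= -[a b]/=.
by rewrite -sqrtr_sqr ler_wsqrtr// lerDl sqr_ge0.
Qed.

Lemma scalar_im_abs z : `|scalar_im z| <= scalar_abs z.
Proof.
rewrite /scalar_abs; case: k z => /= [x|[a b]/=]; first by rewrite normr0.
by rewrite -sqrtr_sqr ler_wsqrtr// lerDr sqr_ge0.
Qed.

Lemma scalar_abs_le z : scalar_abs z <= `|scalar_re z| + `|scalar_im z|.
Proof.
rewrite /scalar_abs; case: k z => /= [x|[a b]/=]; first by rewrite normr0 addr0.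
rewrite -[leRHS]ger0_norm ?addr_ge0// -sqrtr_sqr ler_wsqrtr//.
rewrite sqrrD !real_normK ?num_real// lerD2r lerDl mulrn_wge0// mulr_ge0//.
Qed.

Lemma scalar_normE z : `|z| = scalar_of_real k (scalar_abs z).
Proof. by rewrite /scalar_abs; case: k z. Qed.

Lemma lt_scalar_of_real (a b : R) : (scalar_of_real k a < scalar_of_real k b) = (a < b).
Proof. by case: k => //=; exact: ltcR. Qed.

Lemma le_scalar_of_real (a b : R) : (scalar_of_real k a <= scalar_of_real k b) = (a <= b).
Proof. by case: k => //=; exact: lecR. Qed.

(** In [R[i]] a positive number has zero imaginary part. This turns the radii of balls, which are
    elements of the scalar field, into real numbers. *)
Lemma gt0_scalar_of_real z : 0 < z -> exists2 a : R, 0 < a & z = scalar_of_real k a.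
Proof.
case: k z => /= [a a0|[a b]]; first by exists a.
by rewrite ltcE/= => /andP[/eqP-> a0]; exists a.
Qed.

Lemma cvg_scalar (T : Type) (F : set_system T) {FF : Filter F} (u : T -> scalars R k)
    (l : scalars R k) :
  scalar_re (u t) @[t --> F] --> scalar_re l -> scalar_im (u t) @[t --> F] --> scalar_im l ->
  u @ F --> l.
Proof.
move=> /cvgrPdist_lt ure /cvgrPdist_lt uim; apply/cvgrPdist_lt => e.
move=> e0; have [a a0 ->] := gt0_scalar_of_real _ e0.
have a20 : 0 < a / 2 by rewrite divr_gt0.
apply: filterS2 (ure _ a20) (uim _ a20) => t; rewrite scalar_normE lt_scalar_of_real.
rewrite -scalar_reB -scalar_imB.
by have := scalar_abs_le (l - u t); lra.
Qed.

End scalars.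

(** * Restriction of scalars to the reals *)

Section restriction_of_scalars.
Context {R : realType} {k : scalar_kind}.

(** A new name for the same carrier keeps the module structure over [R] apart from the one over
    [scalars R k]. *)
Definition real_space (U : lmodType (scalars R k)) : Type := U.

Section lmod.
Context (U : lmodType (scalars R k)).
HB.instance Definition _ := GRing.Zmodule.on (real_space U).

Definition real_scale (a : R) (u : real_space U) : real_space U :=
  scalar_of_real k a *: (u : U).

Fact real_scaleA a b u : real_scale a (real_scale b u) = real_scale (a * b) u.
Proof. by rewrite /real_scale scalerA rmorphM. Qed.
Fact real_scale1 : left_id 1 real_scale.
Proof. by move=> u; rewrite /real_scale rmorph1 scale1r. Qed.
Fact real_scaleDr : right_distributive real_scale +%R.
Proof. by move=> a u v; rewrite /real_scale scalerDr. Qed.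
Fact real_scaleDl u : {morph real_scale^~ u : a b / a + b}.
Proof. by move=> a b; rewrite /real_scale rmorphD scalerDl. Qed.

HB.instance Definition _ := GRing.Zmodule_isLmodule.Build R (real_space U)
  real_scaleA real_scale1 real_scaleDr real_scaleDl.
End lmod.

Section dot.
Context (U : lmodType (scalars R k)) (B : {dot U for @scalar_conj R k}).

(** The real part induces the same norm as [B], so completeness and bounds in norm carry over
    unchanged. *)
Definition real_dot (u v : real_space U) : R := scalar_re (B u v).

Fact real_dot_linearl u : linear_for ( *%R \; idfun) (real_dot^~ u).
Proof.
move=> a v w; rewrite /real_dot linearDl linearZl_LR scalar_reD.
by rewrite scalar_reZ.
Qed.

Fact real_dot_linearr u : linear_for (idfun \; *%R) (real_dot u).
Proof.
move=> a v w; rewrite /real_dot linearDr linearZr_LR/= scalar_reD.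
by rewrite scalar_conj_real scalar_reZ.
Qed.

Fact real_dot_bilinear : bilinear_for *%R (idfun \; *%R) real_dot.
Proof.
by split => u a v w; [exact: real_dot_linearl | exact: real_dot_linearr].
Qed.

HB.instance Definition _ := bilinear_isBilinear.Build R (real_space U) (real_space U) R
  (GRing.Scale.Law.clone _ _ ( *%R ) _) (GRing.Scale.Law.clone _ _ (idfun \; *%R ) _)
  real_dot real_dot_bilinear.

Fact real_dot_sym u v : real_dot u v = (-1) ^+ false * idfun (real_dot v u).
Proof.
by rewrite /real_dot hermitian_subproof !expr0 !mul1r scalar_re_conj.
Qed.

HB.instance Definition _ := isHermitianSesquilinear.Build R (real_space U) false idfun
  real_dot real_dot_sym.

Fact real_dot_gt0 u : u != 0 -> 0 < real_dot u u.
Proof. by move=> u0; apply/scalar_re_gt0/neq0_dnorm_gt0. Qed.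

HB.instance Definition _ := isDotProduct.Build R (real_space U) real_dot real_dot_gt0.
End dot.
End restriction_of_scalars.

(** * Bounded sequences in a reproducing kernel Hilbert space *)

Section rkhs_weak_compactness.
Context {R : realType} {k : scalar_kind} {X : Type} (H : rkhs R k X).
Let V : lmodType R := real_space (subspace_type (rkhs_space H)).
Let dot : {dot V for (idfun : R -> R)} := real_dot _ (inner H).

Definition eval_re (x : X) (f : V) : R := scalar_re (val (f : H) x).
Fact eval_re_linear x : linear_for *%R (eval_re x).
Proof. by move=> a f g; rewrite /eval_re/= scalar_reD scalar_reZ. Qed.
HB.instance Definition _ x :=
  GRing.isLinear.Build R V R *%R (eval_re x) (eval_re_linear x).

Definition eval_im (x : X) (f : V) : R := scalar_im (val (f : H) x).
Fact eval_im_linear x : linear_for *%R (eval_im x).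
Proof. by move=> a f g; rewrite /eval_im/= scalar_imD scalar_imZ. Qed.
HB.instance Definition _ x :=
  GRing.isLinear.Build R V R *%R (eval_im x) (eval_im_linear x).

Lemma eval_re_bounded x : bounded_functional dot (eval_re x).
Proof.
have [C hC] := rkhs_eval_bounded H x; exists C => f.
exact: le_trans (scalar_re_abs _) (hC f).
Qed.

Lemma eval_im_bounded x : bounded_functional dot (eval_im x).
Proof.
have [C hC] := rkhs_eval_bounded H x; exists C => f.
exact: le_trans (scalar_im_abs _) (hC f).
Qed.

(** Weak convergence is tested on the real and imaginary parts of evaluations for the pointwise
    limit, and on the inner product with [h] for lower semicontinuity of the norm. *)
Lemma rkhs_bounded_subsequence (f : nat -> H) (M : R) :
  (forall n, rkhs_norm (f n) <= M) ->
  exists (s : nat -> nat) (h : H), [/\ forall n, (n <= s n)%N,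
    forall x, val (f (s n)) x @[n --> \oo] --> val h x &
    forall a, a < rkhs_norm h -> \forall n \near \oo, a < rkhs_norm (f (s n))].
Proof.
move=> fM.
have [s [h [s_ge hs]]] := bounded_weak_subsequence dot (rkhs_complete (r:=H)) f M fM.
exists s, h; split => // [x|a ah].
  apply: cvg_scalar; first exact: (hs _ (eval_re_bounded x)).
  exact: (hs _ (eval_im_bounded x)).
(* When [a] is nonnegative, [h] has positive norm, and the Cauchy-Schwarz inequality can be divided
   by it. *)
have [a0|a0] := ltP a 0.
  by apply: nearW => n; apply: lt_le_trans a0 _; exact: (norm_of_ge0 dot).
have h0 : 0 < rkhs_norm h by exact: le_lt_trans ah.
have := hs _ (dot_fun_bounded dot h).
rewrite [X in _ --> X](_ : _ = rkhs_norm h ^+ 2); last exact/esym/(sqr_norm_of dot).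
move=> /cvgr_gt /(_ (a * rkhs_norm h)); rewrite expr2 ltr_pM2r// => /(_ ah).
apply: filterS => n /= ahn; rewrite -(ltr_pM2r h0); apply: lt_le_trans ahn _.
exact: (cauchy_schwarz dot).
Qed.

End rkhs_weak_compactness.

(** * Second countability of the scalars and Borel measurability *)

Lemma scalar_rat_dense (R : realType) (k : scalar_kind) :
  exists q : rat * rat -> scalars R k, forall (z : scalars R k) (e : R), 0 < e ->
    exists a, scalar_abs (z - q a) < e.
Proof.
have ratr_dense (x e : R) : 0 < e -> exists a : rat, `|x - ratr a| < e.
  move=> e0; have /rat_in_itvoo[a] : x - e < x + e by lra.
  by rewrite in_itv/= => /andP[? ?]; exists a; rewrite ltr_norml; lra.
have [q qE] : exists q : rat * rat -> scalars R k, forall z a,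
    `|scalar_re (z - q a)| + `|scalar_im (z - q a)| <=
    `|scalar_re z - ratr a.1| + `|scalar_im z - ratr a.2|.
  case: k => /=.
    by exists (fun a => ratr a.1) => z a; rewrite normr0 lerD2l.
  by exists (fun a => (ratr a.1 +i* ratr a.2)%C) => -[b c] a.
exists q => z e e0; have e20 : 0 < e / 2 by rewrite divr_gt0.
have [a1 h1] := ratr_dense (scalar_re z) _ e20.
have [a2 h2] := ratr_dense (scalar_im z) _ e20.
exists (a1, a2); have := scalar_abs_le (z - q (a1, a2)); have := qE z (a1, a2).
by move=> /=; lra.
Qed.

Lemma scalars_second_countable (R : realType) (k : scalar_kind) :
  second_countable (T := scalars R k).
Proof.
have [q q_dense] := scalar_rat_dense R k.
pose U (i : rat * rat * nat) : set (scalars R k) :=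
  ball (q i.1) (scalar_of_real k i.2.+1%:R^-1).
have UE i z : U i z <-> scalar_abs (q i.1 - z) < i.2.+1%:R^-1.
  by rewrite /U /ball/= scalar_normE lt_scalar_of_real.
exists (range U); first exact: sub_countable (card_image_le _ _) (countableP _).
split=> [_ [i _ <-]|x A /nbhs_ballP[e /= e0 eA]].
  exact: ball_open.
have [a a0 eE] := gt0_scalar_of_real _ e0.
have a20 : 0 < a / 2 by rewrite divr_gt0.
(* A ball of radius [n.+1%:R^-1 < a / 2] that contains [x] lies in the ball of radius [a] around
   [x]. *)
have [n _ /(_ n (leqnn n)) na] := near_infty_natSinv_lt (PosNum a20).
have [i hi] := q_dense x n.+1%:R^-1 ltac:(by rewrite invr_gt0).
have scalar_absN z : scalar_abs (- z : scalars R k) = scalar_abs z.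
  by rewrite /scalar_abs normrN.
exists (U (i, n)); first by split; [exists (i, n)|apply/UE; rewrite -scalar_absN opprB].
move=> z /UE/= zi; apply: eA; rewrite /ball/= eE scalar_normE lt_scalar_of_real.
have : scalar_abs (x - z) <= scalar_abs (x - q i) + scalar_abs (q i - z).
  have := ler_normD (x - q i) (q i - z); rewrite addrA subrK !scalar_normE -rmorphD.
  by rewrite le_scalar_of_real.
by move=> /le_lt_trans; apply; rewrite [a]splitr ltrD// (lt_trans _ na).
Qed.

(** An open set of the product is a union of rectangles with sides in the two countable bases, so
    its preimage is a countable union of measurable sets. *)
Lemma borel_fun_pair (X S T : ptopologicalType) (f : X -> S) (g : X -> T) :
  second_countable (T := S) -> second_countable (T := T) ->
  borel_fun f -> borel_fun g -> borel_fun (fun x => (f x, g x)).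
Proof.
move=> [BS cBS [oBS bBS]] [BT cBT [oBT bBT]] mf mg.
apply: (@measurability _ _ (borel X) (borel (S * T)%type) setT _
  (@open (S * T)%type)) => // _ [W oW <-].
rewrite setTI.
pose D := [set UV : set S * set T | BS UV.1 /\ BT UV.2 /\ UV.1 `*` UV.2 `<=` W].
rewrite (_ : _ @^-1` W = \bigcup_(UV in D) (f @^-1` UV.1 `&` g @^-1` UV.2)).
  rewrite bigcup_set_type; apply: countable_bigcupT_measurable => [|[[U V] UVD]/=].
    rewrite (eq_countable (card_setT _)); apply: sub_countable (countableX cBS cBT).
    by apply: subset_card_le => -[U V] [? [? _]].
  move: UVD => /set_mem[/= /oBS oU [/oBT oV _]].
  apply: measurableI; rewrite -[X in measurable X]setTI; [apply: mf|apply: mg] => //.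
    exact: sub_sigma_algebra.
  exact: sub_sigma_algebra.
apply/seteqP; split=> x /=.
  move=> Wx; have [[U V]/= [Ux Vx] UV] := open_nbhs_nbhs (conj oW Wx).
  have [U' [BU' U'x] U'U] := bBS _ _ Ux; have [V' [BV' V'x] V'V] := bBT _ _ Vx.
  exists (U', V') => //; split=> //=; split=> // -[a b] [/= /U'U Ua /V'V Vb].
  exact: UV.
by move=> [[U V] [_ [_ UVW]] [/= Ux Vx]]; exact: UVW.
Qed.

Lemma borel_fun_comp (X S T : ptopologicalType) (f : X -> S) (g : S -> T) :
  borel_fun g -> borel_fun f -> borel_fun (g \o f).
Proof. by move=> mg mf; exact: (measurableT_comp mg mf). Qed.

(** Passes from [borel R] to the standard measurable structure of [R], which is generated by open
    intervals. *)
Lemma borel_fun_measurable (R : realType) (X : ptopologicalType) (f : X -> R) :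
  borel_fun f -> measurable_fun [set: borel X] (f : borel X -> R).
Proof.
move=> mf; apply: (measurability _ (RGenOpens.measurableE R)) => _ [_ [a [b ->]] <-].
apply: mf => //; apply: sub_sigma_algebra; exact: interval_open.
Qed.

(** * Bounds for lower limits, as suprema of tail infima *)

Lemma limn_einf_ge {R : realType} (u : nat -> \bar R) (l : R) :
  (forall a : R, a < l -> \forall n \near \oo, (a%:E <= u n)%E) ->
  (l%:E <= limn_einf u)%E.
Proof.
move=> ul; have -> : limn_einf u = ereal_sup (range (einfs u)).
  by rewrite limn_einf_lim; apply/cvg_lim => //; exact: cvg_einfs_sup.
apply/lee_subgt0Pr => e e0; rewrite -EFinB.
have [|N _ hN] := ul (l - e); first by rewrite ltrBlDr ltrDl.
apply: le_trans (ereal_sup_ubound _); last by exists N.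
by apply: le_ereal_inf_tmp => _ [n /= Nn <-]; exact: hN.
Qed.

Lemma limn_einf_le {R : realType} (u : nat -> \bar R) (l : R) :
  (forall a : R, l < a -> \forall n \near \oo, (u n <= a%:E)%E) ->
  (limn_einf u <= l%:E)%E.
Proof.
move=> ul; have -> : limn_einf u = ereal_sup (range (einfs u)).
  by rewrite limn_einf_lim; apply/cvg_lim => //; exact: cvg_einfs_sup.
apply/lee_addgt0Pr => e e0; rewrite -EFinD.
have [|N _ hN] := ul (l + e); first by rewrite ltrDl.
apply: ge_ereal_sup => _ [n _ <-].
apply: le_trans (hN (maxn n N) (leq_maxr _ _)).
by apply: ereal_inf_lbound; exists (maxn n N) => //=; exact: leq_maxl.
Qed.

(** * Existence of an optimizer *)

Section objective.
Context {R : realType} {k : scalar_kind} {X : ptopologicalType} {H : rkhs R k X}.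
Context (H_measurable : forall f : H, borel_fun (val f)).
Context (mu : probability (borel X) R) {p lambda : R} (p_gt0 : 0 < p) (lambda_gt0 : 0 < lambda).
Context {g : X -> scalars R k} (g_measurable : borel_fun g).
Context {c : scalars R k * scalars R k -> R} (c_measurable : borel_fun c).
Context (c_ge0 : forall w, 0 <= c w).
Context (c_integrable : mu.-integrable [set: borel X] (fun x => (c (0, g x))%:E)).

Local Notation J := (@objective R k X H mu p lambda g c).

Lemma rkhs_norm_ge0 (f : H) : 0 <= rkhs_norm f. Proof. exact: sqrtr_ge0. Qed.

Lemma cost_measurable (f : H) :
  measurable_fun [set: borel X] (fun x : borel X => (c (val f x, g x))%:E).
Proof.
have mfg : borel_fun (fun x => (val f x, g x)).
  by apply: borel_fun_pair => //; exact: scalars_second_countable.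
have := borel_fun_measurable _ _ _ (borel_fun_comp _ _ _ _ _ c_measurable mfg).
by move=> mc; exact/(measurable_EFinP _ _).
Qed.

Lemma penalty_ge0 (f : H) : 0 <= lambda * rkhs_norm f `^ p.
Proof. by rewrite mulr_ge0 ?powR_ge0// ltW. Qed.

Lemma cost_integral_ge0 (f : H) : (0 <= \int[mu]_x (c (val f x, g x))%:E)%E.
Proof. by apply: integral_ge0 => x _; rewrite lee_fin. Qed.

Lemma objective_ge0 (f : H) : (0 <= J f)%E.
Proof. by rewrite adde_ge0 ?cost_integral_ge0// lee_fin penalty_ge0. Qed.

Lemma penalty_le_objective (f : H) : ((lambda * rkhs_norm f `^ p)%:E <= J f)%E.
Proof. by rewrite leeDr// cost_integral_ge0. Qed.

(** Integrability of [c (0, g x)] enters here: the zero function has a finite objective, which makes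
    the infimum finite. *)
Lemma objective0_lty : (J (0%R : subspace_type (rkhs_space H)) < +oo)%E.
Proof.
rewrite lte_add_pinfty// ?ltry//.
have /integrableP[_] := c_integrable.
rewrite (eq_integral (fun x : borel X => (c (0, g x))%:E)) => [|x _]; first by [].
by rewrite gee0_abs// lee_fin.
Qed.

(** As [mu] has total mass one, the penalty goes under the integral as a constant, and Fatou's lemma
    applies to cost and penalty together. *)
Lemma objective_integral (f : H) :
  J f = (\int[mu]_x ((c (val f x, g x))%:E + (lambda * rkhs_norm f `^ p)%:E))%E.
Proof.
rewrite ge0_integralD//; first last.
- by move=> x _; rewrite lee_fin penalty_ge0.
- exact: cost_measurable.
- by move=> x _; rewrite lee_fin.
rewrite (integral_cst mu measurableT) [X in (_ * X)%E](_ : _ = 1%E) ?mule1//.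
exact: probability_setT.
Qed.

Lemma objective_inf_fin : ereal_inf (range J) \is a fin_num.
Proof.
rewrite ge0_fin_numE.
  apply: le_lt_trans objective0_lty; apply: ereal_inf_lbound.
  by exists (0 : subspace_type (rkhs_space H)).
by apply: le_ereal_inf_tmp => _ [f _ <-]; exact: objective_ge0.
Qed.

Lemma minimizing_sequence : exists2 f : nat -> H,
  (forall n, J (f n) < ereal_inf (range J) + n.+1%:R^-1%:E)%E &
  exists M, forall n, rkhs_norm (f n) <= M.
Proof.
have /choice[f hf] n : exists f, (J f < ereal_inf (range J) + n.+1%:R^-1%:E)%E.
  have n0 : 0 < n.+1%:R^-1 :> R by rewrite invr_gt0.
  by have [_ [f _ <-] ?] := lb_ereal_inf_adherent n0 objective_inf_fin; exists f.
exists f => //.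
pose r := fine (ereal_inf (range J)).
have rE : ereal_inf (range J) = r%:E by rewrite fineK// objective_inf_fin.
(* The cost is nonnegative, so the penalty alone is at most [r + 1]; solving for the norm gives this
   bound. *)
exists (((r + 1) / lambda) `^ p^-1) => n.
have : lambda * rkhs_norm (f n) `^ p <= r + 1.
  rewrite -lee_fin (le_trans (penalty_le_objective _))// (le_trans (ltW (hf n)))//.
  by rewrite rE -EFinD lee_fin lerD2l invf_le1// ler1n.
rewrite mulrC -ler_pdivlMr// => hr.
rewrite [leLHS](_ : _ = (rkhs_norm (f n) `^ p) `^ p^-1); last first.
  by rewrite -powRrM mulfV ?powRr1 ?rkhs_norm_ge0// lt0r_neq0.
apply: ge0_ler_powR => //; rewrite ?nnegrE ?powR_ge0 ?invr_ge0 ?(ltW p_gt0)//.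
exact: le_trans (powR_ge0 _ _) hr.
Qed.

(** Turns lower bounds on norms into lower bounds on penalties. The threshold is the [p]-th root of
    [b]; for negative [b] any number below [t] will do, as powers are nonnegative. *)
Lemma powR_gt_of_lt (b t : R) : 0 <= t -> b < t `^ p ->
  exists2 a, a < t & forall s, a < s -> 0 <= s -> b < s `^ p.
Proof.
move=> t0 bt; have [b0|b0] := ltP b 0.
  by exists (t - 1) => [|s _ _]; [rewrite ltrBlDr ltrDl|apply: lt_le_trans b0 (powR_ge0 _ _)].
have bE : (b `^ p^-1) `^ p = b by rewrite -powRrM mulVf ?powRr1// lt0r_neq0.
exists (b `^ p^-1) => [|s bs s0].
  rewrite ltNge; apply/negP => tb; move: bt; rewrite ltNge -bE.
  by rewrite ge0_ler_powR ?nnegrE ?powR_ge0// ltW.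
by rewrite -bE gt0_ltr_powR ?nnegrE ?powR_ge0.
Qed.

Context (c_lsc : forall z, lower_semicontinuous (fun w => (c (w, z))%:E)).

Lemma optimizer_exists : exists f : H, optimizer J f.
Proof.
have [f hf [M fM]] := minimizing_sequence.
have [s [h [s_ge hpt hnorm]]] := rkhs_bounded_subsequence H f M fM.
exists h; apply/eqP; rewrite eq_le; apply/andP; split; last first.
  by apply: ereal_inf_lbound; exists h.
pose F n (x : borel X) : \bar R :=
  ((c (val (f (s n)) x, g x))%:E + (lambda * rkhs_norm (f (s n)) `^ p)%:E)%E.
have mF n : measurable_fun [set: borel X] (F n).
  by apply: emeasurable_funD => //; exact: cost_measurable.
have F0 n x : [set: borel X] x -> (0 <= F n x)%E.
  by move=> _; rewrite adde_ge0// lee_fin ?penalty_ge0.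
(* The lower limit of the objectives is at most the infimum since the sequence is minimizing, and at
   least [J h] by Fatou's lemma. *)
apply: (@le_trans _ _ (limn_einf (fun n => J (f (s n))))); last first.
  rewrite -(fineK objective_inf_fin); apply: limn_einf_le => a ra.
  rewrite -subr_gt0 in ra; near=> n; apply: le_trans (ltW (hf (s n))) _.
  rewrite -(fineK objective_inf_fin) -EFinD lee_fin -lerBrDl.
  apply: (@le_trans _ _ n.+1%:R^-1).
    by rewrite lef_pV2 ?posrE// ler_nat ltnS s_ge.
  by near: n; apply: filterS (near_infty_natSinv_lt (PosNum ra)) => n /ltW.
have := fatou mu measurableT mF F0.
under [X in limn_einf X]eq_fun do rewrite -objective_integral.
apply: le_trans; rewrite objective_integral; apply: ge0_le_integral => //.
- by move=> x _; rewrite adde_ge0// lee_fin ?penalty_ge0.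
- by apply: emeasurable_funD => //; exact: cost_measurable.
- rewrite /limn_einf; apply: measurableT_comp; first exact: oppe_measurable.
  apply: (measurable_fun_limn_esup (f := fun n x => (- F n x)%E)) => n.
  by apply: measurableT_comp => //; exact: oppe_measurable.
move=> x _; rewrite -EFinD; apply: limn_einf_ge => a.
set v := c _; set t := _ * _ => avt.
(* The gap between [a] and [v + t] is split evenly: eventually the cost exceeds [v - e], by
   pointwise convergence and semicontinuity, and the penalty exceeds [t - e]. *)
pose e := (v + t - a) / 2.
have e0 : 0 < e by rewrite divr_gt0// subr_gt0.
have [V Vh cV] : exists2 V, nbhs (val h x) V & forall y, V y -> ((v - e)%:E < (c (y, g x))%:E)%E.
  by apply: c_lsc; rewrite lte_fin ltrBlDr ltrDl.
have [b bh hb] : exists2 b, b < rkhs_norm h &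
    forall s, b < s -> 0 <= s -> (t - e) / lambda < s `^ p.
  apply: powR_gt_of_lt; first exact: rkhs_norm_ge0.
  by rewrite ltr_pdivrMr// mulrC -/t ltrBlDr ltrDl.
have hV : \forall n \near \oo, V (val (f (s n)) x) := hpt x _ Vh.
apply: filterS2 hV (hnorm b bh) => n /= /cV; rewrite lte_fin => h1.
move=> /hb /(_ (rkhs_norm_ge0 _)); rewrite ltr_pdivrMr// mulrC => h2.
rewrite /F -EFinD lee_fin.
have : a = v - e + (t - e) by rewrite /e; field.
by move=> ->; rewrite lerD// ltW.
Unshelve. all: by end_near. Qed.

End objective.

(** * Strict convexity of powers *)

(* With u = ln x, adding [1 + (p - 1) u < expR ((p - 1) u)] and (p - 1) times
   [1 - u < expR (- u)] and multiplying by x gives the claim. *)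
Lemma bernoulli_powR_lt {R : realType} (p x : R) : 1 < p -> 0 <= x -> x != 1 ->
  1 + p * (x - 1) < x `^ p.
Proof.
move=> p1; rewrite le_eqVlt => /orP[/eqP<- _|x0 x1].
  by rewrite powR0; [lra|rewrite gt_eqF//; lra].
pose u := ln x.
have u0 : u != 0 by rewrite ln_eq0.
have xE : expR u = x by rewrite lnK.
have h1 : 1 + (p - 1) * u < expR ((p - 1) * u).
  by apply: expR_gt1Dx; rewrite mulf_neq0// gt_eqF// subr_gt0.
have h2 : 1 - u < expR (- u) by apply: expR_gt1Dx; rewrite oppr_eq0.
have e1 : expR ((p - 1) * u) * x = x `^ p.
  by rewrite /powR gt_eqF// -{1}xE -expRD; congr expR; rewrite /u; ring.
have e2 : expR (- u) * x = 1 by rewrite -{1}xE -expRD addNr expR0.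
have h3 : (1 - u) * (p - 1) < expR (- u) * (p - 1) by rewrite ltr_pM2r// subr_gt0.
have : p * x < (expR ((p - 1) * u) + expR (- u) * (p - 1)) * x.
  by rewrite ltr_pM2r//; lra.
by rewrite mulrDl e1 mulrAC e2; lra.
Qed.

(** Bernoulli's inequality is applied to [a / m] and [b / m], where [m] is the mean. Neither ratio
    is 1, and the linear terms cancel because the ratios add up to 2. *)
Lemma powR_midpoint_lt {R : realType} (p a b : R) : 1 < p -> 0 <= a -> 0 <= b ->
  a != b -> ((a + b) / 2) `^ p < (a `^ p + b `^ p) / 2.
Proof.
move=> p1 a0 b0 ab; set m := (a + b) / 2.
have m0 : 0 < m.
  rewrite divr_gt0// lt_neqAle addr_ge0// andbT eq_sym paddr_eq0//.
  apply: contraNN ab => /andP[/eqP-> /eqP->]; exact: eqxx.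
have neq1 x y : (x + y) / 2 = m -> x != y -> x / m != 1.
  move=> xym xy; apply: contra_neq xy => /(congr1 ( *%R^~ m)); rewrite divfK ?gt_eqF// mul1r -xym.
  lra.
have powE x : 0 <= x -> x `^ p = (x / m) `^ p * m `^ p.
  move=> x0; rewrite -powRM ?divfK//; [by rewrite gt_eqF|by rewrite divr_ge0// ltW|exact: ltW].
have ha := bernoulli_powR_lt p (a / m) p1 (divr_ge0 a0 (ltW m0)) (neq1 a b erefl ab).
have hb := bernoulli_powR_lt p (b / m) p1 (divr_ge0 b0 (ltW m0)).
rewrite (powE a)// (powE b)// -mulrDl mulrAC ltr_pMl ?powR_gt0//.
have {}hb : 1 + p * (b / m - 1) < (b / m) `^ p.
  by apply/hb/(neq1 b a); rewrite 1?addrC// eq_sym.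
have e : a / m + b / m = 2.
  by rewrite -mulrDl -[a + b](divfK (_ : 2 != 0 :> R))// -/m mulrAC divff ?mul1r// gt_eqF.
have : p * (a / m - 1) + p * (b / m - 1) = 0 by rewrite -mulrDr; nra.
lra.
Qed.

(** * Uniqueness of the optimizer *)

Section uniqueness.
Context {R : realType} {k : scalar_kind} {X : ptopologicalType} {H : rkhs R k X}.

Definition midpoint (f1 f2 : subspace_type (rkhs_space H)) : H :=
  scalar_of_real k 2^-1 *: (f1 + f2).

(** If the norms agree, the parallelogram law makes the midpoint strictly shorter. If they differ,
    strictness comes from the power, after the triangle inequality. *)
Lemma rkhs_norm_midpoint_lt (p : R) (f1 f2 : subspace_type (rkhs_space H)) :
  1 < p -> f1 != f2 ->
  rkhs_norm (midpoint f1 f2) `^ p < (rkhs_norm f1 `^ p + rkhs_norm f2 `^ p) / 2.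
Proof.
move=> p1 f12.
have p0 : 0 < p by exact: lt_trans p1.
have d0 : 0 < @rkhs_norm R k X H (f1 - f2) ^+ 2.
  rewrite (sqr_norm_of (real_dot _ (inner H))); apply: (neq0_dnorm_gt0 (s := real_dot _ (inner H))).
  by rewrite subr_eq0.
have := parallelogram (real_dot _ (inner H)) f1 f2.
set n1 := @rkhs_norm R k X H f1; set n2 := @rkhs_norm R k X H f2.
set nm := rkhs_norm (midpoint f1 f2); set d := rkhs_norm _ in d0 *.
move=> par; have {}par : d ^+ 2 = 2 * n1 ^+ 2 + 2 * n2 ^+ 2 - 4 * nm ^+ 2 by exact: par.
have n10 : 0 <= n1 by exact: rkhs_norm_ge0.
have n20 : 0 <= n2 by exact: rkhs_norm_ge0.
have nm0 : 0 <= nm by exact: rkhs_norm_ge0.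
have [n12|n12] := eqVneq n1 n2.
  have : nm < n1 by rewrite -(@ltr_pXn2r _ 2)//; move: par; rewrite -n12; lra.
  rewrite -n12 => /(gt0_ltr_powR p0 nm0 n10)/=; lra.
apply: le_lt_trans (powR_midpoint_lt _ _ _ p1 n10 n20 n12).
apply: ge0_ler_powR; rewrite ?nnegrE ?divr_ge0 ?addr_ge0// ?(ltW p0)//.
exact: (norm_of_midpoint_le (real_dot _ (inner H))).
Qed.

Context (H_measurable : forall f : H, borel_fun (val f)).
Context (mu : probability (borel X) R) {p lambda : R} (p_gt1 : 1 < p) (lambda_gt0 : 0 < lambda).
Context {g : X -> scalars R k} (g_measurable : borel_fun g).
Context {c : scalars R k * scalars R k -> R} (c_measurable : borel_fun c).
Context (c_ge0 : forall w, 0 <= c w).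
Context (c_convex : forall z, convex_scalar_fun (fun w => c (w, z))).

Local Notation J := (@objective R k X H mu p lambda g c).

Lemma objective_midpoint_lt (f1 f2 : subspace_type (rkhs_space H)) (m : R) :
  f1 != f2 -> J f1 = m%:E -> J f2 = m%:E -> (J (midpoint f1 f2) < m%:E)%E.
Proof.
move=> f12.
have I_ge0 (f : H) : (0 <= \int[mu]_x (c (val f x, g x))%:E)%E by exact: cost_integral_ge0.
(* A finite objective has a finite cost integral, so the strict gain in the penalty is not absorbed
   by an infinite cost. *)
have fin f : J f = m%:E -> exists2 r : R,
    (\int[mu]_x (c (val f x, g x))%:E = r%:E)%E & m = r + lambda * rkhs_norm f `^ p.
  rewrite /objective; have := I_ge0 f.
  case: (\int[mu]_x _)%E => [r _|//|//]; rewrite -EFinD => -[<-]; by exists r.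
move=> /fin[r1 I1 m1] /fin[r2 I2 m2].
have mc (f : H) := cost_measurable H_measurable g_measurable c_measurable f.
have : (\int[mu]_x (c (val (midpoint f1 f2) x, g x))%:E <= (2^-1 * (r1 + r2))%:E)%E.
  have mean : (\int[mu]_x (2^-1%:E * ((c (val f1 x, g x))%:E + (c (val f2 x, g x))%:E)) =
      (2^-1 * (r1 + r2))%:E)%E.
    rewrite ge0_integralZl//; first last.
    - by move=> x _; rewrite adde_ge0// lee_fin.
    - exact: emeasurable_funD (mc f1) (mc f2).
    rewrite ge0_integralD//; first last.
    - by move=> x _; rewrite lee_fin.
    - by move=> x _; rewrite lee_fin.
    by rewrite I1 I2.
  rewrite -mean.
  apply: ge0_le_integral => //.
  - by move=> x _; rewrite lee_fin.
  - by apply: measurable_funeM; exact: emeasurable_funD (mc f1) (mc f2).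
  move=> x _; rewrite -EFinD -EFinM lee_fin.
  have := c_convex (g x) (val f1 x) (val f2 x) 2^-1.
  have -> : 1 - 2^-1 = 2^-1 :> R by field.
  by rewrite -!mulrDr; apply; lra.
rewrite /objective => hI; apply: le_lt_trans (leeD hI (lexx _)) _.
rewrite -EFinD lte_fin.
have := rkhs_norm_midpoint_lt p f1 f2 p_gt1 f12; rewrite -(ltr_pM2l lambda_gt0).
by move: m1 m2; lra.
Qed.

End uniqueness.

Theorem theorem2p6 (R : realType) (k : scalar_kind) (X : ptopologicalType)
    (X_polish : polish R X)
    (K : X -> X -> scalars R k) (H : rkhs R k X)
    (H_kernel : reproducing_kernel H = K)
    (H_measurable : forall f : H, borel_fun (val f))
    (mu : probability (borel X) R)
    (p lambda : R) (p_gt0 : 0 < p) (lambda_gt0 : 0 < lambda)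
    (g : X -> scalars R k) (g_measurable : borel_fun g)
    (c : scalars R k * scalars R k -> R) (c_measurable : borel_fun c)
    (c_ge0 : forall w, 0 <= c w)
    (c_integrable : mu.-integrable [set: borel X] (fun x => (c (0, g x))%:E))
    (c_lsc : forall z, lower_semicontinuous (fun w => (c (w, z))%:E)) :
  (exists fhat : H, optimizer (objective mu p lambda g c) fhat) /\
  (1 < p -> (forall z, convex_scalar_fun (fun w => c (w, z))) ->
    exists! fhat : H, optimizer (objective mu p lambda g c) fhat).
Proof.
have [f f_opt] := optimizer_exists H_measurable mu p_gt0 lambda_gt0 g_measurable
  c_measurable c_ge0 c_integrable c_lsc.
split; first by exists f.
move=> p_gt1 c_convex; exists f; split => // f' f'_opt; apply: contrapT => ff'.
(* Since the infimum is finite, both optimizers attain the same real value, and their midpoint would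
   fall strictly below it. *)
have inf_fin := objective_inf_fin (H := H) mu lambda_gt0 c_ge0 c_integrable (p := p).
have mid_lt : (objective mu p lambda g c (midpoint f f') <
    (fine (ereal_inf (range (objective (H := H) mu p lambda g c))))%:E)%E.
  apply: objective_midpoint_lt => //; rewrite ?fineK//.
  exact/eqP.
move: mid_lt; rewrite fineK// ltNge => /negP; apply.
by apply: ereal_inf_lbound; exists (midpoint f f').
Qed.
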